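(* Let $G$ be a finite solvable group such that $\mathcal{E}^{**}(G)$ is claw-free. Let $F(G)$ be the Fitting subgroup of $G$ and let $F_2(G)$ denote the preimage in $G$ of $F(G/F(G))$. Then either $F(G)$ and $G/F(G)$ are both cyclic, or the following hold: (1) $F(G)/\mathrm{Cyc}(G)$ is a non-cyclic $p$-group for some prime $p$. (2) If $G$ is not nilpotent, then $F_2(G)/\mathrm{Cyc}(G)$ is a Frobenius group with Frobenius kernel $F(G)/\mathrm{Cyc}(G)$, and $F_2(G)/F(G)$ is cyclic. (3) If $G\neq F_2(G)$, then $G/F_2(G)$ is a $p$-group (for the same prime $p$) and $G/\mathrm{Cyc}(G)$ is a $2$-Frobenius group.
   Context: For a finite group $G$, the enhanced power graph $\mathcal{E}(G)$ is the graph with vertex set $G$ in which two distinct vertices $u,v$ are adjacent if and only if $\langle u,v\rangle$ is cyclic. A vertex is dominating if it is adjacent to all other vertices. The proper enhanced power graph $\mathcal{E}^{**}(G)$ is the subgraph of $\mathcal{E}(G)$ induced on the non-dominating vertices. The cyclicizer $\mathrm{Cyc}(G)=\{x\in G\mid \langle x,y\rangle \text{ is cyclic for every } y\in G\}$ is the set of dominating vertices of $\mathcal{E}(G)$; it is a cyclic subgroup of $Z(G)$. A graph is claw-free if it has no induced subgraph isomorphic to $K_{1,3}$. A group $X$ is a $2$-Frobenius group if it has normal subgroups $1<H<K<X$ such that $K$ is a Frobenius group with kernel $H$ and $X/H$ is a Frobenius group with kernel $K/H$. *)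

(* Defs.v *)
From mathcomp Require Import all_boot all_fingroup all_solvable.

Set Implicit Arguments.
Unset Strict Implicit.
Unset Printing Implicit Defensive.

Local Open Scope group_scope.

(* A finite simple graph is given by a vertex set V : {set T} and an adjacency
   relation e : rel T, of which only the restriction to V matters; the subgraph
   induced on W \subset V is then (W, e). *)
Section Graphs.

Variable T : finType.
Implicit Types (V : {set T}) (e : rel T).

Definition dominating V e (x : T) : bool :=
  (x \in V) && [forall y in V, (y != x) ==> e x y].

Definition nondominating V e : {set T} := [set x in V | ~~ dominating V e x].

(* K_{1,3}, with centre ord0 *)
Definition claw : rel 'I_4 :=
  [rel i j | (i != j) && ((i == ord0) || (j == ord0))].

Definition claw_free V e : Prop :=
  ~ exists f : 'I_4 -> T,
      [/\ injective f, forall i, f i \in V & forall i j, e (f i) (f j) = claw i j].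

End Graphs.

Section EnhancedPowerGraph.

Variable gT : finGroupType.
Implicit Types G X : {group gT}.

Definition epg_adj : rel gT := [rel u v | (u != v) && cyclic <<[set u; v]>>].

(* The vertex set of the proper enhanced power graph of G *)
Definition pepg_vertices G : {set gT} := nondominating G epg_adj.

Definition pepg_claw_free G : Prop := claw_free (pepg_vertices G) epg_adj.

Definition cyclicizer (A : {set gT}) : {set gT} :=
  [set x in A | [forall y in A, cyclic <<[set x; y]>>]].

Lemma cyclicizer_group_set G : group_set (cyclicizer G).
Proof.
apply/group_setP; split=> [|x z].
  rewrite inE group1; apply/forall_inP=> y Gy.
  apply: (cyclicS _ (cycle_cyclic y)).
  by rewrite gen_subG subUset !sub1set group1 cycle_id.
rewrite !inE => /andP[Gx /forall_inP Cx] /andP[Gz /forall_inP Cz].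
rewrite groupM //; apply/forall_inP=> y Gy.
have /cyclicP[w Dw] := Cz y Gy.
have Gw: w \in G.
  rewrite -cycle_subG -Dw gen_subG subUset !sub1set Gz; exact: Gy.
have sw: <[w]> \subset <<[set x; w]>>.
  by rewrite cycle_subG mem_gen // !inE eqxx orbT.
have in_w u : u \in [set z; y] -> u \in <<[set x; w]>>.
  by move=> zyu; apply: (subsetP sw); rewrite -Dw mem_gen.
apply: cyclicS (Cx w Gw).
have xX: x \in <<[set x; w]>> by rewrite mem_gen // !inE eqxx.
have zX: z \in <<[set x; w]>> by rewrite in_w // !inE eqxx.
have yX: y \in <<[set x; w]>> by rewrite in_w // !inE eqxx orbT.
by rewrite gen_subG subUset !sub1set groupM.
Qed.

Canonical cyclicizer_group G := Group (cyclicizer_group_set G).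

Lemma dominating_cyclicizer G x : dominating G epg_adj x = (x \in cyclicizer G).
Proof.
rewrite inE /dominating; case Gx: (x \in G) => //=.
apply/forall_inP/forall_inP=> Dx y Gy.
  have [-> | nyx] := eqVneq y x; first by rewrite setUid cycle_cyclic.
  by have:= Dx y Gy; rewrite nyx => /andP[].
by apply/implyP=> nyx; apply/andP; split; [rewrite eq_sym | apply: Dx].
Qed.

Definition Fitting2 (A : {set gT}) : {set gT} :=
  coset 'F(A) @*^-1 'F(A / 'F(A)).

Canonical Fitting2_group G := Eval hnf in [group of Fitting2 G].

Lemma Fitting2_sub G : Fitting2 G \subset G.
Proof.
by rewrite sub_cosetpre_quo ?Fitting_normal // Fitting_sub.
Qed.

Definition two_Frobenius X : Prop :=
  exists H K : {group gT},
    [/\ [/\ H <| X & K <| X],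
        [/\ H :!=: 1, H \proper K & K \proper X],
        [Frobenius K with kernel H]
      & [Frobenius X / H with kernel K / H]].

End EnhancedPowerGraph.

(* Main.v *)
Require Import Defs.
From mathcomp Require Import all_boot all_fingroup all_solvable.
From mathcomp Require Import ssralg.

(* Two elements are joined when they generate a cyclic group.  Joinedness passes
   to and from G / Cyc(G), so one may assume Cyc(G) = 1; claw-freeness then says
   that no x != 1 is joined to three pairwise unjoined elements.

   Two consequences do all the work.  First, since a noncyclic group contains
   three pairwise unjoined elements, a subgroup all of whose elements are joined
   to some x != 1 is cyclic.  Second, if k is joined to x != 1 and acts coprimely
   on a group A centralising x, then the A-conjugates of <[k]> are all joined to
   x, so there are at most two of them and k centralises a subgroup of index at
   most 2 of A, hence A itself.

   If F(G) is not cyclic it is therefore a p-group on which every nontrivial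
   p'-element acts without fixed points, and F_2(G) = F(G) ><| K with K cyclic.
   For a prime q <> p, the q-elements of N_G(K) centralise K: otherwise one of
   order q would form with a Sylow subgroup R of K a Frobenius group acting on
   Z(F(G)) with neither R nor the complement having fixed points, which a
   comparison of orbit sums excludes.  Hence N_G(K) / K is a p-group,
   acting without fixed points on K.

   If F(G) is cyclic then G / F(G) is abelian, and for a Sylow q-subgroup Q of G
   the image of Q in G / F(G) is a quotient of the cyclic group of automorphisms
   induced by Q on a subgroup of F(G) of prime order r <> q. *)

Set Implicit Arguments.
Unset Strict Implicit.
Unset Printing Implicit Defensive.

Local Open Scope group_scope.

(** * Coprime action and the Fitting subgroup *)

Lemma index_le2_normal (gT : finGroupType) (G H : {group gT}) :
  H \subset G -> #|G : H| <= 2 -> H <| G.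
Proof.
move=> sHG; rewrite leq_eqVlt ltnS => /orP[/eqP/index2_normal-> // | ind1].
have H_G: H :=: G by apply: index1g => //; apply/eqP; rewrite eqn_leq ind1 indexg_gt0.
by rewrite H_G normal_refl.
Qed.

(** The fixed points of [A] form a normal subgroup of index at most 2, so [A] acts trivially on the
    quotient; as fixed points lift through coprime quotients, the quotient is trivial. *)
Lemma index_le2_coprime_cent (gT : finGroupType) (A K : {group gT}) :
    A \subset 'N(K) -> coprime #|K| #|A| -> solvable K ->
  #|K : 'C_K(A)| <= 2 -> A \subset 'C(K).
Proof.
move=> nKA coKA solK ind2.
have sBK: 'C_K(A) \subset K := subsetIl _ _.
have /andP[_ nBK] := index_le2_normal sBK ind2.
have nBA: A \subset 'N('C_K(A)).
  by rewrite normsI ?norms_cent ?normG.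
have := coprime_quotient_cent sBK nBA coKA solK.
rewrite trivg_quotient => /esym/eqP C1.
have cAK: A / 'C_K(A) \subset 'C(K / 'C_K(A)).
  have: #|K / 'C_K(A)| <= 2 by rewrite card_quotient.
  rewrite (cardsD1 1) group1 add1n ltnS leq_eqVlt ltnS leqn0 => /orP[]; last first.
    by rewrite cards_eq0 setD_eq0 subG1 => /eqP->; rewrite cents1.
  case/cards1P=> x defx; apply/centsP=> a Aa y Ky; apply/esym/commgP/conjg_fixP.
  have [-> | nty] := eqVneq y 1; first exact: conj1g.
  have K1: {in K / 'C_K(A), forall z, z != 1 -> z = x}.
    by move=> z Kz ntz; apply/set1P; rewrite -defx !inE ntz.
  rewrite (K1 y) // (K1 (x ^ a)) // -?(K1 y) ?conjg_eq1 //.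
  by rewrite memJ_norm // (subsetP _ _ Aa) // quotient_norms.
rewrite (setIidPl _) in C1; last by rewrite centsC.
rewrite -subG1 quotient_sub1 // in C1.
by rewrite centsC; apply: subset_trans C1 (subsetIr _ _).
Qed.

Lemma nilpotent_der1_sub_center (gT : finGroupType) (G : {group gT}) :
  G^`(1) \subset 'Z(G) -> nilpotent G.
Proof.
by rewrite -nil_class2 => nilG; apply: small_nil_class; apply: leq_trans nilG _.
Qed.

(** Descent along the derived series of the centraliser: a term whose successor lies in ['F(G)] has
    central derived subgroup, so it is nilpotent and normal in [G], hence lies in ['F(G)]. *)
Lemma cent_sub_Fitting (gT : finGroupType) (G : {group gT}) :
  solvable G -> 'C_G('F(G)) \subset 'F(G).
Proof.
move=> solG; set C := 'C_G('F(G))%G; change (C \subset 'F(G)).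
have nsCG: C <| G.
  by rewrite /normal subsetIl normsI ?normG ?norms_cent ?gFnorm.
have solC: solvable C := solvableS (subsetIl _ _) solG.
have [n Cn] := derivedP _ solC.
have: C^`(n) \subset 'F(G) by rewrite Cn sub1G.
elim: n {Cn} => // n IHn sC'F; apply: IHn.
have sCnC: C^`(n) \subset C := der_sub n C.
apply: Fitting_max; first exact: gFnormal_trans.
apply: nilpotent_der1_sub_center; rewrite subsetI der_sub.
by rewrite (subset_trans sC'F) // centsC (subset_trans sCnC) ?subsetIr.
Qed.

Lemma nilpotent_central_quotient (gT : finGroupType) (G Z : {group gT}) :
  Z \subset 'Z(G) -> nilpotent (G / Z) -> nilpotent G.
Proof.
move=> sZ nilGZ; rewrite -quotient_center_nil.
have nZG: Z <| G := sub_center_normal sZ.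
rewrite -(isog_nil (third_isog sZ nZG (center_normal G))).
exact: quotient_nil.
Qed.

(** * Orbit sums and fixed points *)

Section FixedPoints.

Import FiniteModule.

(** The sum over all of [M] is [M]-invariant, hence zero, and its term at 1 is [v]. *)
Lemma sum_actr_fixfree (gT : finGroupType) (V M : {group gT}) (abelV : abelian V) :
    M \subset 'N(V) -> 'C_V(M) = 1 -> forall v : fmod_of abelV,
  (\sum_(m in M^#) v ^@ m = - v)%R.
Proof.
move=> nVM CV1 v; apply/eqP; rewrite -GRing.addr_eq0 GRing.addrC.
rewrite -{1}(actr1 v) -(big_setD1 1 (group1 M)) /=; set w := (\sum_(m in M) _)%R.
suff: val w \in 'C_V(M) by rewrite CV1 => /set1P w1; apply/eqP/val_inj.
rewrite inE fmodP; apply/centP=> m Mm; apply/commgP/conjg_fixP.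
rewrite -fmvalJ ?(subsetP nVM) //; congr (val _).
rewrite /w (actr_sum m) /= (reindex_inj (mulIg m^-1)) /=.
apply: eq_big => [x | x Mx]; first by rewrite groupMr ?groupV.
rewrite -actrM ?mulgKV //; last exact: subsetP nVM _ Mm.
by rewrite (subsetP nVM) // -(groupMr _ (groupVr Mm)).
Qed.

(** The orbit sum of [v] over [M^#] is [- v], and so is the sum over each block [X^#]. Adding up the
    blocks shows that [#|P|.-1] annihilates [V]. *)
Lemma fixfree_partition_trivg (gT : finGroupType) (V M : {group gT})
    (P : {set {group gT}}) :
    abelian V -> M \subset 'N(V) ->
    partition [set X^# | X : {group gT} in P] M^# ->
    {in P, forall X : {group gT}, 'C_V(X) = 1} -> coprime #|V| #|P|.-1 ->
  V :=: 1.
Proof.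
move=> abelV nVM partP CV1 coVP.
have injP: {in P &, injective (fun X : {group gT} => X^#)}.
  move=> X Y _ _ /= eqXY; apply: val_inj => /=.
  by rewrite -(setD1K (group1 X)) eqXY setD1K.
(* If [P] is empty, [#|P|.-1] is 0, and coprimality with 0 means [#|V| = 1]. *)
have [P0 | [X0 PX0]] := set_0Vmem P.
  by apply: card1_trivg; apply/eqP; move: coVP; rewrite P0 cards0 /= /coprime gcdn0.
have sPM X: X \in P -> X \subset M.
  move=> PX; rewrite -(setD1K (group1 X)) subUset sub1set group1 /=.
  apply: subset_trans (subsetDl M [set 1]); rewrite -(cover_partition partP).
  by apply/bigcup_max/subxx; apply: imset_f PX.
have CVM: 'C_V(M) = 1.
  by apply/trivgP; rewrite -(CV1 _ PX0) setIS ?centS ?sPM.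
apply/trivgP/subsetP=> x Vx; apply/set1P.
pose v := fmod abelV x; pose n := #|P|.-1.
have vP: (v *+ n = 0)%R.
  have:= sum_actr_fixfree nVM CVM v.
  rewrite (set_partition_big _ partP) /= big_imset //=.
  rewrite (eq_bigr (fun _ => - v)%R) => [|X PX]; last first.
    by rewrite sum_actr_fixfree ?CV1 // (subset_trans (sPM X PX)).
  rewrite GRing.sumr_const (cardsD1 X0) PX0 GRing.mulrS => /eqP.
  rewrite -GRing.subr_eq0 GRing.addrAC GRing.subrr GRing.add0r.
  by rewrite GRing.mulNrn GRing.oppr_eq0 /n (cardsD1 X0 P) PX0 => /eqP.
have xn: x ^+ n = 1.
  by have := congr1 val vP; rewrite fmvalZ fmodK.
apply/eqP; rewrite -order_eq1 -dvdn1 -(eqP coVP) dvdn_gcd order_dvdG //=.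
by rewrite order_dvdn xn.
Qed.

End FixedPoints.

(** The blocks are [K^#] and the [#|K|] conjugates of [H^#]: one less than their number is [#|K|],
    coprime to [#|V|]. *)
Lemma Frobenius_fix_compl (gT : finGroupType) (V M K H : {group gT}) :
    [Frobenius M = K ><| H] -> abelian V -> M \subset 'N(V) ->
    coprime #|V| #|K| -> 'C_V(K) = 1 -> 'C_V(H) = 1 ->
  V :=: 1.
Proof.
move=> frobM abelV nVM coVK CK CH.
have [defM ntK ntH _ _] := Frobenius_context frobM.
have [_ mulKH nKH tiKH] := sdprodP defM.
pose HK := [set (H :^ x)%G | x in K].
have HK_D: [set X^# | X : {group gT} in HK] = H^# :^: K.
  rewrite -imset_comp; apply: eq_imset => x /=.
  by rewrite conjD1g.
have defP: [set X^# | X : {group gT} in K |: HK] = K^# |: H^# :^: K.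
  by rewrite imsetU imset_set1 HK_D.
(* An element of [K] normalising [H] has its commutators with [H] in [K :&: H = 1], so it
   centralises [H] and is trivial. *)
have oHK: #|HK| = #|K|.
  apply: card_in_imset => x y Kx Ky /(congr1 val) /= eqHxy.
  have Kxy: x * y^-1 \in K by rewrite groupM ?groupV.
  have Nxy: x * y^-1 \in 'N(H) by apply/normP; rewrite conjsgM eqHxy conjsgK.
  have: x * y^-1 \in 'C_K(H).
    rewrite inE Kxy; apply/centP=> h Hh; apply/commgP.
    rewrite -in_set1 -[[set 1]]tiKH inE {1}commgEl commgEr.
    rewrite groupMl ?groupV // memJ_norm ?Kxy ?(subsetP nKH) //=.
    by rewrite groupMr // memJ_norm ?groupV.
  by rewrite (Frobenius_trivg_cent frobM) => /set1P/eqP; rewrite -eq_mulgV1 => /eqP.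
have K'HK: K \notin HK.
  apply: contra ntK => /imsetP[x Kx /(congr1 val) /= eqKH].
  by rewrite -subG1 -tiKH subsetI subxx -(conjSg _ _ x) -eqKH conjGid ?subxx.
apply: (@fixfree_partition_trivg _ V M (K |: HK)) => //.
(* [Frobenius_partition] covers [M] and has [K] itself as a block; 1 has to be removed from that
   block. *)
- have /and3P[/eqP covM triv nz] := Frobenius_partition frobM.
  have H1K: gval K \notin H^# :^: K.
    by apply/imsetP=> [[x _ defK]]; have:= group1 K; rewrite defK conjD1g !inE eqxx.
  have KHK'1: cover (H^# :^: K) :\ 1 = cover (H^# :^: K).
    apply/setDidPl; rewrite disjoint_sym disjoints1.
    apply/bigcupP=> [[X /imsetP[x _ ->]]].
    by rewrite conjD1g !inE eqxx.
  have trivHK: trivIset (H^# :^: K) := trivIsetS (subsetUr _ _) triv.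
  have nzHK: set0 \notin H^# :^: K by apply: contra nz; apply: setU1r.
  have disjK X: X \in H^# :^: K -> [disjoint K^# & X].
    move=> KX; apply: disjointWl (subsetDl _ _) _.
    apply: (trivIsetP triv); rewrite ?setU11 ?setU1r //.
    by apply: contraNneq H1K => defK; rewrite {1}defK.
  have [triv1 K1'] := trivIsetU1 disjK trivHK nzHK.
  rewrite defP /partition triv1 !inE negb_or nzHK [set0 == _]eq_sym setD_eq0.
  rewrite subG1 ntK !andbT.
  rewrite -covM /cover !big_setU1 //= setDUl -/(cover _); apply/eqP; congr (_ :|: _).
  by rewrite KHK'1.
- move=> X /setU1P[-> // | /imsetP[x Kx ->]] /=.
  have nVx: x \in 'N(V) by rewrite (subsetP nVM) // -mulKH (subsetP (mulG_subl H K)).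
  by rewrite -(normP nVx) centJ -conjIg CH conjs1g.
- by rewrite cardsU1 K'HK oHK.
Qed.

(** The blocks are the [q + 1] subgroups of order [q], and one less than their number is [q]. *)
Lemma fixfree_abelem2 (gT : finGroupType) (V E : {group gT}) (q : nat) :
    prime q -> q.-abelem E -> #|E| = (q ^ 2)%N -> abelian V -> E \subset 'N(V) ->
    coprime #|V| q -> {in E^#, forall e, 'C_V[e] = 1} ->
  V :=: 1.
Proof.
move=> pr_q abelE oE abelV nVE coVq CV1.
have ordE: {in E^#, forall e, #[e] = q}.
  by move=> e /setD1P[nte Ee]; apply: (abelem_order_p abelE).
pose P := [set <[e]>%G | e in E^#].
have genE e f : e \in E^# -> f \in <[e]>^# -> <[e]> = <[f]>.
  move=> E'e /setD1P[ntf ef]; apply/esym/eqP; rewrite eqEcard cycle_subG ef /=.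
  have E'f: f \in E^#.
    case/setD1P: E'e => _ Ee; rewrite !inE ntf (subsetP _ _ ef) //.
    by rewrite cycle_subG.
  by rewrite -!orderE !ordE.
have partP: partition [set X^# | X : {group gT} in P] E^#.
  have injP X : X \in [set X^# | X : {group gT} in P] ->
    exists2 e, e \in E^# & X = <[e]>^#.
    by case/imsetP=> _ /imsetP[e E'e ->] ->; exists e.
  apply/and3P; split.
  - rewrite eqEsubset; apply/andP; split.
      apply/bigcupsP=> _ /injP[e /setD1P[_ Ee] ->].
      by rewrite setSD ?cycle_subG.
    apply/subsetP=> e E'e; apply/bigcupP; exists <[e]>^#.
      by apply: (imset_f (fun X : {group gT} => X^#)); apply: imset_f.
    by case/setD1P: E'e => nte Ee; rewrite !inE nte cycle_id.
  - apply/trivIsetP=> _ _ /injP[e E'e ->] /injP[f E'f ->].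
    apply: contraR => /pred0Pn[g /andP[/= eg fg]].
    by rewrite (genE e g) // (genE f g).
  apply/negP=> /injP[e E'e /setP/(_ e)]; case/setD1P: E'e => nte Ee.
  by rewrite !inE nte cycle_id.
have oP: #|P| = q.+1.
  have oE1: #|E^#| = (q.-1 * q.+1)%N.
    have ->: #|E^#| = (q ^ 2).-1 by rewrite -oE (cardsD1 1 E) group1.
    by rewrite -subn1 -{2}(exp1n 2) subn_sqr subn1 addn1.
  have: #|E^#| = (#|[set X^# | X : {group gT} in P]| * q.-1)%N.
    apply: card_uniform_partition partP => _ /imsetP[_ /imsetP[e E'e ->] ->] /=.
    have := cardsD1 1 <[e]>; rewrite group1 -orderE ordE // => ->.
    by rewrite add1n.
  rewrite oE1 mulnC => /eqP; rewrite eqn_pmul2r; last first.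
    by rewrite -ltnS prednK ?prime_gt1 ?prime_gt0.
  move/eqP->; rewrite card_in_imset // => X Y _ _ /= eqXY; apply: val_inj => /=.
  by rewrite -(setD1K (group1 X)) eqXY setD1K.
apply: (fixfree_partition_trivg abelV nVE partP); last by rewrite oP.
by move=> _ /imsetP[e E'e ->] /=; rewrite cent_cycle CV1.
Qed.

(** Otherwise the two cycles span an elementary abelian group of rank 2, and [fixfree_abelem2]
    forces [V] to be trivial. *)
Lemma fixfree_prime_order_cycle (gT : finGroupType) (V : {group gT}) (x y : gT) :
    prime #[y] -> #[x] = #[y] -> commute x y -> abelian V -> V :!=: 1 ->
    <[x]> * <[y]> \subset 'N(V) -> coprime #|V| #[y] ->
    {in (<[x]> * <[y]>)^#, forall e, 'C_V[e] = 1} ->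
  x \in <[y]>.
Proof.
move=> pr_q ox cxy abelV ntV nVE coVq CV1; apply: contraNT ntV => y'x; apply/eqP.
have cXY: <[y]> \subset 'C(<[x]>) by rewrite cents_cycle.
have tiXY: <[x]> :&: <[y]> = 1 by rewrite prime_TIg -?orderE ?ox ?cycle_subG.
rewrite -(cent_joinEr cXY) in nVE CV1.
apply: (fixfree_abelem2 pr_q) nVE coVq CV1 => //.

  rewrite (cprod_abelem _ (cprodEY cXY)); apply/andP; split.
    by rewrite -ox prime_abelem // -?orderE ox.
  by rewrite prime_abelem.
by rewrite /= cent_joinEr // TI_cardMg // -!orderE ox.
Qed.

(** * Joined elements *)

Section Joined.

Variable gT : finGroupType.
Implicit Types (x y z : gT) (A G : {group gT}).

(** The adjacency [epg_adj] made reflexive. *)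
Definition joined x y := cyclic <<[set x; y]>>.

Lemma joinedC x y : joined x y = joined y x.
Proof. by rewrite /joined setUC. Qed.

Lemma joinedP x y : reflect (exists2 z, x \in <[z]> & y \in <[z]>) (joined x y).
Proof.
apply: (iffP cyclicP) => [[z defz] | [z zx zy]].
  by exists z; rewrite -defz mem_gen // !inE eqxx ?orbT.
apply/cyclicP/(cyclicS _ (cycle_cyclic z)).
by rewrite gen_subG subUset !sub1set zx.
Qed.

Lemma joinedJ x y z : joined (x ^ z) (y ^ z) = joined x y.
Proof.
apply/joinedP/joinedP=> [] [t tx ty]; last first.
  by exists (t ^ z); rewrite cycleJ memJ_conjg.
by exists (t ^ z^-1); rewrite cycleJ mem_conjgV.
Qed.

Lemma joined_commute x y : joined x y -> commute x y.
Proof.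
case/joinedP=> z zx zy; exact: (centsP (cycle_abelian z)).
Qed.

Lemma joined_coprime x y : commute x y -> coprime #[x] #[y] -> joined x y.
Proof.
move=> cxy co_xy; apply/joinedP; exists (x * y); rewrite cycleM //.
  by rewrite (subsetP (mulG_subl _ _)) ?cycle_id.
by rewrite (subsetP (mulG_subr _ _)) ?cycle_id.
Qed.

(** A cyclic group has at most one subgroup of each order. *)
Lemma joined_eq_order x y : joined x y -> #[x] = #[y] -> <[x]> = <[y]>.
Proof.
case/joinedP=> z zx zy oxy; apply/eqP.
by rewrite (eq_subG_cyclic (cycle_cyclic z)) ?cycle_subG // -!orderE oxy.
Qed.

(* Generators of two distinct maximal cyclic subgroups <[a]> and <[b]>, and of one
   that contains a * b. *)
Lemma noncyclic_three_unjoined A : ~~ cyclic A ->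
  exists a b c, [/\ a \in A, b \in A & c \in A]
    /\ [/\ ~~ joined a b, ~~ joined a c & ~~ joined b c].
Proof.
move=> ncA; pose cyc := [pred X : {group gT} | cyclic X & X \subset A].
have maxJ (a d : gT) (X : {group gT}) : 
    maxgroup X cyc -> X :=: <[a]> -> d \in A -> joined a d -> d \in X.
  move=> /maxgroupP[/andP[/= _ sXA] maxX] defX Ad jad.
  have <-: <<[set a; d]>>%G :=: X.
    apply: maxX; rewrite /= ?gen_subG ?subUset ?sub1set ?Ad ?andbT.
      by rewrite -cycle_subG -defX sXA andbT; apply: jad.
    by rewrite /= defX cycle_subG mem_gen // !inE eqxx.
  by rewrite /= mem_gen // !inE eqxx orbT.
have ex_max d : d \in A -> exists2 a, a \in A &
    exists2 X : {group gT}, maxgroup X cyc /\ X :=: <[a]> & d \in X.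
  move=> Ad; have /maxgroup_exists[X maxX sdX]: cyc <[d]>%G.
    by rewrite /= cycle_cyclic cycle_subG.
  have /maxgroupP[/andP[/cyclicP[a defX] sXA] _] := maxX.
  exists a; first by rewrite -cycle_subG -defX.
  by exists X; rewrite -?cycle_subG.
have [a Aa [X [maxX defX] _]] := ex_max 1 (group1 A).
have [b0 Ab0 X'b0]: exists2 b, b \in A & b \notin X.
  apply/subsetPn; apply: contra ncA => sAX.
  by apply: (cyclicS sAX); rewrite defX cycle_cyclic.
have [b Ab [Y [maxY defY] Yb0]] := ex_max b0 Ab0.
have X'b: ~~ joined a b.
  apply: contra X'b0 => /(maxJ _ _ _ maxX defX Ab); rewrite -cycle_subG -defY.
  by move/subsetP; apply.
have Xa: a \in X by rewrite defX cycle_id.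
have Yb: b \in Y by rewrite defY cycle_id.
have X'b1: b \notin X.
  by apply: contra X'b => Xb; apply/joinedP; exists a; rewrite ?cycle_id -?defX.
have Y'a: a \notin Y.
  by apply: contra X'b => Ya; apply/joinedP; exists b; rewrite ?cycle_id -?defY.
have [c Ac [Z [maxZ defZ] Zab]] := ex_max (a * b) (groupM Aa Ab).
have inZ (W : {group gT}) : c \in W -> a * b \in W.
  by rewrite -cycle_subG -defZ => /subsetP; apply.
(* If [c] were joined to [a], maximality would put [c], hence [a * b], hence [b], in [X]; likewise
   with [b] and [Y]. *)
exists a, b, c; do !split => //.
  apply: contra X'b1 => /(maxJ _ _ _ maxX defX Ac)/inZ.
  by rewrite groupMl.
apply: contra Y'a => /(maxJ _ _ _ maxY defY Ac)/inZ.
by rewrite groupMr.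
Qed.

(** Coincidences among the four elements make the conclusion automatic, by reflexivity of [joined];
    the content is that no claw is centred at a nontrivial element. *)
Definition at_most_two_joined G :=
  forall x a b c, x \in G -> x != 1 -> a \in G -> b \in G -> c \in G ->
    joined x a -> joined x b -> joined x c ->
  [|| joined a b, joined a c | joined b c].

End Joined.

Section AtMostTwo.

Variables (gT : finGroupType) (G : {group gT}).
Hypothesis two_joined : at_most_two_joined G.

Lemma joined_all_cyclic (A : {group gT}) x :
    A \subset G -> x \in G -> x != 1 -> {in A, forall a, joined x a} ->
  cyclic A.
Proof.
move=> sAG Gx ntx jxA; apply: contraT => /noncyclic_three_unjoined.
case=> a [b [c [[Aa Ab Ac] [/negPf jab /negPf jac /negPf jbc]]]].
have inG := subsetP sAG.
have := two_joined Gx ntx (inG a Aa) (inG b Ab) (inG c Ac)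
  (jxA a Aa) (jxA b Ab) (jxA c Ac).
by rewrite jab jac jbc.
Qed.

Lemma joined_centralizes (A : {group gT}) x k :
    x \in G -> x != 1 -> k \in G -> joined x k ->
    A \subset G -> A \subset 'C[x] -> k \in 'N(A) -> coprime #|A| #[k] -> solvable A ->
  k \in 'C(A).
Proof.
move=> Gx ntx Gk jxk sAG cAx nAk coAk solA.
rewrite -cycle_subG.
have nAK : <[k]> \subset 'N(A) by rewrite cycle_subG.
apply: index_le2_coprime_cent => //.
(* By coprimality the index of the centraliser counts the [A]-conjugates of [<[k]>]. *)
have ->: 'C_A(<[k]>) = 'N_A(<[k]>).
  by rewrite coprime_norm_cent.
rewrite -card_conjugates.
have jK a : a \in A -> joined x (k ^ a).
  move=> Aa; move: jxk; rewrite -(joinedJ x k a) [x ^ a]conjgE.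
  by rewrite -(cent1P (subsetP cAx a Aa)) mulKg.
have jE a b : a \in A -> b \in A -> joined (k ^ a) (k ^ b) -> <[k]> :^ a = <[k]> :^ b.
  by move=> Aa Ab jab; rewrite -!cycleJ; apply: joined_eq_order; rewrite ?orderJ.
rewrite leqNgt; apply/negP=> /card_gt2P[X [Y [Z [[AX AY AZ] [nXY nYZ nZX]]]]].
have [[a Aa defX] [b Ab defY]] := (imsetP AX, imsetP AY).
have [c Ac defZ] := imsetP AZ.
have inG a0 : a0 \in A -> k ^ a0 \in G by move=> Aa0; rewrite groupJ // (subsetP sAG).
have := two_joined Gx ntx (inG a Aa) (inG b Ab) (inG c Ac)
  (jK a Aa) (jK b Ab) (jK c Ac).
case/or3P=> /jE eq_conj.
- by rewrite defX defY eq_conj ?eqxx in nXY.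
- by rewrite defZ defX eq_conj ?eqxx in nZX.
by rewrite defY defZ eq_conj ?eqxx in nYZ.
Qed.

End AtMostTwo.

(** * Cyclic Fitting subgroup *)

Lemma nilpotent_quotient_cyclic (gT : finGroupType) (G N : {group gT}) :
    N <| G -> nilpotent (G / N) ->
    (forall q (Q : {group gT}), prime q -> q.-Sylow(G) Q -> cyclic (Q / N)) ->
  cyclic (G / N).
Proof.
move=> nsNG nilGN cycQ; apply: nil_Zgroup_cyclic nilGN.
apply/forall_inP=> V /SylowP[q pr_q sylV]; have [Q sylQ] := Sylow_exists q G.
have nNQ: Q \subset 'N(N) := subset_trans (pHall_sub sylQ) (normal_norm nsNG).
have [x _ ->] := Sylow_trans (quotient_pHall nNQ sylQ) sylV.
by rewrite cyclicJ (cycQ q).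
Qed.

Lemma der1_sub_cent_cyclic (gT : finGroupType) (G A : {group gT}) :
  G \subset 'N(A) -> cyclic A -> G^`(1) \subset 'C(A).
Proof.
move=> nAG cycA; rewrite -ker_conj_aut ker_trivg_morphim.
rewrite (subset_trans (der_sub 1 G)) //= morphim_der // subG1 /=.
by apply/eqP/derG1P/(abelianS (Aut_conj_aut _ _))/Aut_cyclic_abelian.
Qed.

Lemma cyclic_quotient_cent_prime (gT : finGroupType) (G R : {group gT}) :
  prime #|R| -> G \subset 'N(R) -> cyclic (G / 'C_G(R)).
Proof.
move=> prR nRG; have := first_isog_loc (conj_aut R) nRG.
rewrite ker_conj_aut => /isog_cyclic->.
exact: cyclicS (Aut_conj_aut _ _) (Aut_prime_cyclic prR).
Qed.

Lemma cyclic_Fitting_quotient (gT : finGroupType) (G : {group gT}) :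
    at_most_two_joined G -> solvable G -> cyclic 'F(G) ->
  cyclic (G / 'F(G)).
Proof.
move=> two_joined solG cycF; have abF := cyclic_abelian cycF.
have nsFG : 'F(G) <| G := Fitting_normal G; have [sFG nFG] := andP nsFG.
have sG'F: G^`(1) \subset 'F(G).
  apply: subset_trans (cent_sub_Fitting solG).
  by rewrite subsetI der_sub der1_sub_cent_cyclic.
apply: nilpotent_quotient_cyclic => //.
  by apply/abelian_nil/sub_der1_abelian.
move=> q Q pr_q sylQ; have [sQG qQ _] := and3P sylQ.
(* [G / 'F(G)] is abelian, so every subgroup between ['F(G)] and [G] is normal. *)
have sGM_F (M : {group gT}) :
  'F(G) \subset M -> M \subset G -> nilpotent M -> M \subset 'F(G).
  move=> sFM sMG; apply: Fitting_max; apply: sub_der1_normal => //.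
  exact: subset_trans sFM.
have /dprodP[_ defF _ _] := nilpotent_pcoreC q (Fitting_nil G).
have sFqQ: 'O_q('F(G)) \subset Q.
  by rewrite p_core_Fitting pcore_sub_Hall.
have sR0F: 'O_q^'('F(G)) \subset 'F(G) := pcore_sub _ _.
set R0 := 'O_q^'('F(G))%G in defF sR0F.
have [R0_1 | ntR0] := eqVneq (R0 :> {set gT}) 1.
  suff sQF: Q \subset 'F(G) by rewrite quotientS1 ?cyclic1.
  apply: sGM_F => //; last exact: pgroup_nil qQ.
  by rewrite -defF R0_1 mulg1.
(* [<[x]>] has prime order [r <> q] and is normal in [G], being characteristic in the cyclic group
   ['F(G)]. *)
have [r pr_r rR0] := pdivP (etrans (cardG_gt1 R0) ntR0).
have [x R0x ox] := Cauchy pr_r rR0.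
have q'R0: q^'.-group R0 := pcore_pgroup _ _.
have ntx: x != 1 by rewrite -order_gt1 ox prime_gt1.
have Gx: x \in G by rewrite (subsetP sFG) ?(subsetP sR0F).
have nRG: G \subset 'N(<[x]>).
  have: <[x]> \char 'F(G) by rewrite sub_cyclic_char // cycle_subG (subsetP sR0F).
  by move/char_normal_trans/(_ nsFG)/normal_norm.
have sDQ: 'C_Q(<[x]>) \subset Q := subsetIl _ _.
have nR0G: G \subset 'N(R0) by rewrite gFnorm_trans.
(* A [q]-element centralising [x] is joined to it and acts coprimely on [R0]. *)
have cDR0: 'C_Q(<[x]>) \subset 'C(R0).
  apply/subsetP=> d /setIP[Qd]; rewrite cent_cycle => cxd.
  have Gd := subsetP sQG d Qd; have qd := mem_p_elt qQ Qd.
  apply: (joined_centralizes two_joined Gx ntx Gd) => //.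
  - apply: joined_coprime; first exact/commute_sym/cent1P.
    rewrite coprime_sym; exact: pnat_coprime qd (mem_p_elt q'R0 R0x).
  - exact: subset_trans sFG.
  - rewrite -cent_cycle centsC cycle_subG (subsetP (centS sR0F)) //.
    by rewrite (subsetP abF) // (subsetP sR0F).
  - exact: subsetP nR0G d Gd.
  - by rewrite coprime_sym; apply: pnat_coprime qd q'R0.
  exact: abelian_sol (abelianS sR0F abF).
(* The central product of [R0] and ['O_q('F(G)) <*> 'C_Q(<[x]>)] is nilpotent and contains ['F(G)],
   so it lies in ['F(G)]. *)
have sDF: 'C_Q(<[x]>) \subset 'F(G).
  have cOD: 'O_q('F(G)) <*> 'C_Q(<[x]>) \subset 'C(R0).
    rewrite join_subG cDR0 andbT (subset_trans (pcore_sub _ _)) //.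
    by rewrite (subset_trans abF) ?centS.
  have sODQ: 'O_q('F(G)) <*> 'C_Q(<[x]>) \subset Q by rewrite join_subG sFqQ.
  have sDM: 'C_Q(<[x]>) \subset R0 <*> ('O_q('F(G)) <*> 'C_Q(<[x]>)).
    by rewrite joingA joing_subr.
  apply: subset_trans sDM _; apply: sGM_F.
  - rewrite -{1}defF mul_subG ?joing_subl //.
    exact: subset_trans (joing_subl _ _) (joing_subr _ _).
  - by rewrite join_subG (subset_trans sR0F) // (subset_trans sODQ).
  rewrite (cprod_nil (cprodEY cOD)) (nilpotentS sR0F (Fitting_nil G)).
  exact: pgroup_nil (pgroupS sODQ qQ).
have nxQ := subset_trans sQG nRG.
have nDQ: Q \subset 'N('C_Q(<[x]>)) by rewrite normsI ?normG ?norms_cent.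
have /homgP[f <-] := homg_quotientS nDQ (subset_trans sQG nFG) sDF.
by rewrite morphim_cyclic // cyclic_quotient_cent_prime // -orderE ox.
Qed.

(** * Noncyclic Fitting subgroup *)

Section FixedPointFree.

Variables (gT : finGroupType) (G : {group gT}).
Hypotheses (two_joined : at_most_two_joined G) (solG : solvable G).
Hypothesis ncF : ~~ cyclic 'F(G).

(** Some Sylow subgroup [V] of ['F(G)] is noncyclic; a nontrivial [p']-element of ['F(G)] would be
    joined to all of [V]. *)
Lemma Fitting_primary : exists2 p : nat, prime p & p.-group 'F(G).
Proof.
have nilF := Fitting_nil G.
have: ~~ Zgroup 'F(G) by apply: contra ncF => /nil_Zgroup_cyclic->.
case/forall_inPn=> V /SylowP[p pr_p sylV] ncV; exists p => //.
have /dprodP[_ defF cFF _] := nilpotent_pcoreC p nilF.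
suff F1: 'O_p^'('F(G)) = 1.
  by rewrite -{1}defF F1 mulg1 pcore_pgroup.
apply/eqP/idPn=> /trivgPn[x F'x ntx]; case/negP: ncV.
have Gx: x \in G by rewrite (subsetP (Fitting_sub G)) // (subsetP (pcore_sub _ _) _ F'x).
have sVG: V \subset G := subset_trans (pHall_sub sylV) (Fitting_sub G).
apply: (joined_all_cyclic two_joined sVG Gx ntx) => a Va; apply: joined_coprime.
  rewrite (nilpotent_Hall_pcore nilF sylV) in Va.
  exact: (centsP cFF _ F'x _ Va).
have pa := mem_p_elt (pHall_pgroup sylV) Va.
by rewrite coprime_sym; apply: pnat_coprime pa (mem_p_elt (pcore_pgroup _ _) F'x).
Qed.

Variable p : nat.
Hypothesis pF : p.-group 'F(G).

Let sFG : 'F(G) \subset G := Fitting_sub G.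
Let nFG : G \subset 'N('F(G)) := gFnorm _ _.

Lemma Fitting_center_neq1 : 'Z('F(G)) != 1.
Proof.
rewrite center_nil_eq1 ?Fitting_nil //.
by apply: contraNneq ncF => ->; apply: cyclic1.
Qed.

(** If [k] centralises some [x != 1] in ['F(G)], it centralises ['C_('F(G))[x]], which contains the
    centre. Repeating this with a central [z != 1] in place of [x], [k] centralises ['F(G)], so it
    lies in this [p]-group. *)
Lemma p'elt_fixfree k : k \in G -> p^'.-elt k -> k != 1 -> 'C_('F(G))[k] = 1.
Proof.
move=> Gk p'k ntk.
have coFk: coprime #|'F(G)| #[k] := pnat_coprime pF p'k.
have cent_cent x : x \in 'F(G) -> x != 1 -> x \in 'C[k] -> k \in 'C('C_('F(G))[x]).
  move=> Fx ntx ckx; have Gx := subsetP sFG x Fx.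
  apply: (joined_centralizes two_joined Gx ntx Gk).
  - apply: joined_coprime; first exact/cent1P.
    exact: pnat_coprime (mem_p_elt pF Fx) p'k.
  - by rewrite subIset ?sFG.
  - exact: subsetIr.
  - have cxk: k \in 'C[x] by rewrite cent1C.
    apply: (subsetP (normsI (subsetIl _ _) (subsetIr 'N('F(G)) 'N('C[x])))).
    by rewrite inE (subsetP nFG) // (subsetP (normG _)).
  - exact: coprime_dvdl (cardSg (subsetIl _ _)) coFk.
  by rewrite (solvableS _ solG) ?subIset ?sFG.
apply/eqP/idPn=> /trivgPn[x /setIP[Fx ckx] ntx].
have [z Zz ntz] := trivgPn _ Fitting_center_neq1; have /setIP[Fz /centP cFz] := Zz.
have ckz: z \in 'C[k].
  apply/cent1P/commute_sym/(centP (cent_cent x Fx ntx ckx)).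
  by rewrite inE Fz; apply/cent1P; apply: cFz.
have cFk: k \in 'C('F(G)).
  rewrite (subsetP _ _ (cent_cent z Fz ntz ckz)) // centS // subsetI subxx.
  by apply/subsetP=> y Fy; apply/cent1P/commute_sym; exact: cFz.
have Fk: k \in 'F(G) by rewrite (subsetP (cent_sub_Fitting solG)) // inE Gk.
case/negP: ntk; rewrite -order_eq1; apply/eqP/(pnat_1 (mem_p_elt pF Fk) p'k).
Qed.

Lemma p'group_fixfree (A : {group gT}) :
  A \subset G -> p^'.-group A -> A :!=: 1 -> 'C_('F(G))(A) = 1.
Proof.
move=> sAG p'A /trivgPn[k Ak ntk]; apply/trivgP.
rewrite -(p'elt_fixfree (subsetP sAG k Ak) (mem_p_elt p'A Ak) ntk) setIS //.
by rewrite -cent_cycle centS ?cycle_subG.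
Qed.

Lemma p'group_fixfree_center (A : {group gT}) :
  A \subset G -> p^'.-group A -> A :!=: 1 -> 'C_('Z('F(G)))(A) = 1.
Proof.
move=> sAG p'A ntA; apply/trivgP.
by rewrite -(p'group_fixfree sAG p'A ntA) setSI ?center_sub.
Qed.

(** Let [z] in ['Z(Q)] have order [q]. By [fixfree_prime_order_cycle] on ['Z('F(G))], [z] lies in
    every nontrivial cyclic subgroup of [Q], so all of [Q] is joined to [z]. *)
Lemma qgroup_cyclic q (Q : {group gT}) :
  q != p -> q.-group Q -> Q \subset G -> cyclic Q.
Proof.
move=> neqqp qQ sQG; have [-> | ntQ] := eqVneq (Q :> {set gT}) 1; first exact: cyclic1.
have [pr_q _ _] := pgroup_pdiv qQ ntQ.
have p'Q: p^'.-group Q by apply: pi_pgroup qQ _; rewrite inE.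
have ntZ: 'Z(Q) != 1 by rewrite center_nil_eq1 ?(pgroup_nil qQ).
have [_ qZ _] := pgroup_pdiv (pgroupS (center_sub Q) qQ) ntZ.
have [z Zz oz] := Cauchy pr_q qZ; have /setIP[Qz /centP cQz] := Zz.
have ntz: z != 1 by rewrite -order_gt1 oz prime_gt1.
apply: (joined_all_cyclic two_joined sQG (subsetP sQG z Qz) ntz) => w Qw.
have [-> | ntw] := eqVneq w 1.
  by apply/joinedP; exists z; rewrite ?cycle_id.
have sWQ: <[w]> \subset Q by rewrite cycle_subG.
have ntW: <[w]> != 1 by rewrite cycle_eq1.
have [_ qw _] := pgroup_pdiv (pgroupS sWQ qQ) ntW.
have [y Wy oy] := Cauchy pr_q qw.
apply/joinedP; exists w; rewrite ?cycle_id // -cycle_subG.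
apply: subset_trans (_ : <[y]> \subset _); rewrite cycle_subG //.
have Qy := subsetP sWQ y Wy.
have sZYQ: <[z]> * <[y]> \subset Q by rewrite mul_subG ?cycle_subG.
apply: (@fixfree_prime_order_cycle _ 'Z('F(G))%G); rewrite ?oy ?oz //.
- exact: cQz.
- exact: center_abelian.
- exact: Fitting_center_neq1.
- by rewrite (subset_trans sZYQ) // (subset_trans sQG) // gFnorm_trans.
- rewrite -oy; apply: pnat_coprime (pgroupS (center_sub _) pF) _.
  exact: mem_p_elt p'Q Qy.
move=> e /setD1P[nte ZYe]; have Qe := subsetP sZYQ e ZYe.
rewrite -cent_cycle; apply: p'group_fixfree_center; rewrite ?cycle_subG ?cycle_eq1 //.
  exact: subsetP sQG e Qe.
exact: mem_p_elt p'Q Qe.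
Qed.

End FixedPointFree.

(** * The second Fitting subgroup *)

Lemma Fitting_sub_Fitting2 (gT : finGroupType) (G : {group gT}) :
  'F(G) \subset Fitting2 G.
Proof. exact: sub_cosetpre. Qed.

Lemma Fitting2_normal (gT : finGroupType) (G : {group gT}) : Fitting2 G <| G.
Proof.
have := Fitting_normal (G / 'F(G)).
by rewrite -cosetpre_normal quotientGK ?Fitting_normal.
Qed.

Lemma quotient_Fitting2 (gT : finGroupType) (G : {group gT}) :
  Fitting2 G / 'F(G) = 'F(G / 'F(G)).
Proof. exact: cosetpreK. Qed.

(** A solvable group with trivial Fitting subgroup is trivial, since the Fitting subgroup contains
    its centraliser. *)
Lemma Fitting2_eq (gT : finGroupType) (G : {group gT}) :
  solvable G -> (Fitting2 G == 'F(G)) = (G == 'F(G) :> {set gT}).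
Proof.
move=> solG; apply/eqP/eqP=> eqF; last first.
  apply/eqP; rewrite eqEsubset Fitting_sub_Fitting2 andbT.
  by rewrite (subset_trans (Fitting2_sub G)) // {1}eqF.
have := cent_sub_Fitting (quotient_sol 'F(G) solG).
rewrite -quotient_Fitting2 eqF trivg_quotient cent1T setIT.
rewrite quotient_sub1 ?gFnorm // => sGF; apply/eqP.
by rewrite eqEsubset sGF Fitting_sub.
Qed.

(** * The structure of [G] above a noncyclic Fitting subgroup *)

Section NoncyclicFitting.

Variables (gT : finGroupType) (G : {group gT}).
Hypotheses (two_joined : at_most_two_joined G) (solG : solvable G).
Hypothesis ncF : ~~ cyclic 'F(G).
Variable p : nat.
Hypothesis pF : p.-group 'F(G).

Let sFG : 'F(G) \subset G := Fitting_sub G.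
Let nFG : G \subset 'N('F(G)) := gFnorm _ _.

(** ['F(G)] is ['O_p(G)], so [G / 'F(G)] has trivial [p]-core. *)
Lemma p'Fitting2_quotient : p^'.-group (Fitting2 G / 'F(G)).
Proof.
have eqFO: 'F(G) = 'O_p(G) by rewrite -p_core_Fitting pcore_pgroup_id.
rewrite quotient_Fitting2; have nilFF := Fitting_nil (G / 'F(G)).
have /dprodP[_ /= defFF _ _] := nilpotent_pcoreC p nilFF.
have O1: 'O_p('F(G / 'F(G))) = 1 by rewrite p_core_Fitting eqFO trivg_pcore_quotient.
by rewrite -defFF O1 mul1g pcore_pgroup.
Qed.

(** A Schur-Zassenhaus complement is isomorphic to the nilpotent group ['F(G / 'F(G))], and its
    Sylow subgroups are cyclic by [qgroup_cyclic]. *)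
Lemma Fitting2_complement :
  exists K : {group gT}, [/\ 'F(G) ><| K = Fitting2 G, p^'.-group K & cyclic K].
Proof.
have sF2G := Fitting2_sub G; have sFF2 := Fitting_sub_Fitting2 G.
have nsFF2 : 'F(G) <| Fitting2 G := normalS sFF2 sF2G (Fitting_normal G).
have hallF : Hall (Fitting2 G) 'F(G).
  rewrite /Hall sFF2 -card_quotient ?(normal_norm nsFF2) //.
  exact: pnat_coprime pF p'Fitting2_quotient.
have /splitsP[K /complP[tiFK defF2]] := SchurZassenhaus_split hallF nsFF2.
have sKF2: K \subset Fitting2 G by rewrite -defF2 mulG_subr.
have nFK := subset_trans sKF2 (normal_norm nsFF2).
have sdF2: 'F(G) ><| K = Fitting2 G by rewrite sdprodE.
have isoK := sdprod_isog sdF2.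
have p'K : p^'.-group K.
  by rewrite /pgroup (card_isog isoK); apply: p'Fitting2_quotient.
exists K; split=> //; apply: nil_Zgroup_cyclic; last first.
  by rewrite (isog_nil isoK) /= quotient_Fitting2 Fitting_nil.
apply/forall_inP=> Q /SylowP[q pr_q sylQ]; have [sQK qQ _] := and3P sylQ.
have [-> | ntQ] := eqVneq (Q :> {set gT}) 1; first exact: cyclic1.
apply: (qgroup_cyclic two_joined solG ncF pF _ qQ).
  have [_ qdvQ _] := pgroup_pdiv qQ ntQ.
  exact: (pgroupP (pgroupS sQK p'K)) pr_q qdvQ.
by rewrite (subset_trans sQK) // (subset_trans sKF2).
Qed.

Variable K : {group gT}.
Hypotheses (defF2 : 'F(G) ><| K = Fitting2 G) (p'K : p^'.-group K).
Hypotheses (cycK : cyclic K) (ntK : K :!=: 1).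

Let sKF2 : K \subset Fitting2 G.
Proof. by have [_ <- _ _] := sdprodP defF2; rewrite mulG_subr. Qed.
Let sKG : K \subset G := subset_trans sKF2 (Fitting2_sub G).
Let tiFK : 'F(G) :&: K = 1. Proof. by have [] := sdprodP defF2. Qed.
Let mulFK : 'F(G) * K = Fitting2 G. Proof. by have [] := sdprodP defF2. Qed.
Let N := 'N_G(K)%G.
Let sNG : N \subset G := subsetIl _ _.
Let nKN : N \subset 'N(K) := subsetIr _ _.
Let sKN : K \subset N. Proof. by rewrite subsetI sKG normG. Qed.

Lemma Frobenius_Fitting2 : [Frobenius Fitting2 G with kernel 'F(G)].
Proof.
apply/existsP; exists K; apply/Frobenius_semiregularP=> //.
  by apply: contraNneq ncF => ->; apply: cyclic1.
move=> k /setD1P[ntk Kk].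
exact: (p'elt_fixfree two_joined solG ncF pF (subsetP sKG k Kk) (mem_p_elt p'K Kk)).
Qed.

(** The Frattini argument for the Hall subgroup [K] of [Fitting2 G] gives the product; the
    intersection ['N_('F(G))(K)] equals ['C_('F(G))(K) = 1] by coprimality. *)
Lemma norm_complement_sdprod : 'F(G) ><| N = G.
Proof.
apply: etrans (sdprodE (subset_trans sNG nFG) _) _; last first.
  have solF2 : solvable (Fitting2 G) := solvableS (Fitting2_sub G) solG.
  have [_ hallK] := coprime_mulpG_Hall mulFK pF p'K.
  rewrite -[RHS](Hall_Frattini_arg solF2 (Fitting2_normal G) hallK).
  by rewrite /= -[in RHS]mulFK -mulgA (mulSGid sKN).
have coFK := pnat_coprime pF p'K.
rewrite setIA (setIidPl sFG) coprime_norm_cent ?(subset_trans sKG) //.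
exact: (p'group_fixfree two_joined solG ncF pF).
Qed.

Let tiFN : 'F(G) :&: N = 1. Proof. by have [] := sdprodP norm_complement_sdprod. Qed.
Let mulFN : 'F(G) * N = G. Proof. by have [] := sdprodP norm_complement_sdprod. Qed.

Lemma norm_complement_Fitting2 : N :&: Fitting2 G = K.
Proof. by rewrite -mulFK -group_modr // setIC tiFN mul1g. Qed.

(** Modulo ['F(G)], the group [K] becomes ['F(G / 'F(G))], which contains its centraliser; hence
    ['C_N(K)] lies in [N :&: Fitting2 G]. *)
Lemma cent_complement_sub : 'C_N(K) \subset K.
Proof.
apply: (@subset_trans _ _ (N :&: Fitting2 G)); last by rewrite norm_complement_Fitting2.
rewrite subsetI subsetIl /=.
have sCG : 'C_N(K) \subset G := subset_trans (subsetIl _ _) sNG.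
rewrite -sub_quotient_pre ?(subset_trans sCG) //.
apply: subset_trans (cent_sub_Fitting (quotient_sol 'F(G) solG)).
rewrite subsetI quotientS //= -quotient_Fitting2 -mulFK quotientMidl.
exact: subset_trans (quotientS _ (subsetIr _ _)) (quotient_cent _ _).
Qed.

Lemma qgroup_cent_complement q (Q : {group gT}) :
  q != p -> q.-group Q -> Q \subset N -> Q \subset 'C(K).
Proof.
move=> neqqp qQ sQN; apply/subsetP=> y Qy.
have [-> | nty] := eqVneq y 1; first exact: group1.
have Ny := subsetP sQN y Qy; have Gy := subsetP sNG y Ny.
have qy := mem_p_elt qQ Qy.
have ntY: <[y]> != 1 by rewrite cycle_eq1.
have [pr_q qdvy _] := pgroup_pdiv qy ntY.
rewrite -(Sylow_gen K) cent_gen; apply/centP=> z /bigcupP[R /SylowP[r pr_r sylR] Rz].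
suff: y \in 'C(R) by move/centP; apply.
have {z Rz} [sRK rR _] := and3P sylR.
have nRN: N \subset 'N(R).
  have: R \char K by rewrite sub_cyclic_char.
  by move/char_norm_trans; apply.
have sRG := subset_trans sRK sKG.
have nRy := subsetP nRN y Ny.
have [eqrq | neqrq] := eqVneq r q.
  have qR: q.-group R by rewrite -eqrq.
  have nRY: <[y]> \subset 'N(R) by rewrite cycle_subG.
  have: cyclic (R <*> <[y]>).
    apply: (qgroup_cyclic two_joined solG ncF pF neqqp).
      by rewrite /= norm_joinEr // pgroupM qR.
    by rewrite join_subG sRG cycle_subG.
  move/cyclic_abelian/centsP => cRY.
  apply/centP=> x Rx; apply: cRY; last by rewrite mem_gen // inE Rx.
  by rewrite mem_gen // inE cycle_id orbT.
(* The power [u] of [y], of order [q], has a nontrivial fixed point in [R] by [Frobenius_fix_compl],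
   so it centralises [R]; then [y], joined to [u], does too. *)
have [u Yu ou] := Cauchy pr_q qdvy.
have Gu: u \in G by rewrite (subsetP _ _ Yu) // cycle_subG.
have ntu: u != 1 by rewrite -order_gt1 ou prime_gt1.
have nRu: u \in 'N(R) by rewrite (subsetP _ _ Yu) // cycle_subG.
have coRy: coprime #|R| #[y].
  by apply: pnat_coprime rR _; apply: pi_pgroup qy _; rewrite !inE eq_sym.
have coRu: coprime #|R| #[u] by apply: coprime_dvdr (order_dvdG Yu) coRy.
have abR: abelian R := abelianS sRK (cyclic_abelian cycK).
have cRu: u \in 'C(R).
  have [-> | ntR] := eqVneq (R :> {set gT}) 1; first by rewrite cent1T inE.
  have: 'C_R[u] != 1.
    apply: contra (Fitting_center_neq1 ncF) => /eqP CRu; apply/eqP.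
    have sdRU: R ><| <[u]> = R <*> <[u]>.
      by rewrite sdprodEY ?cycle_subG // coprime_TIg.
    have frobRU: [Frobenius R <*> <[u]> = R ><| <[u]>].
      apply/prime_FrobeniusP; rewrite -?orderE ?ou //.
      by rewrite cent_cycle.
    have p'R: p^'.-group R := pgroupS sRK p'K.
    have sRUG: R <*> <[u]> \subset G by rewrite join_subG sRG cycle_subG.
    apply: (Frobenius_fix_compl frobRU).
    - exact: center_abelian.
    - by rewrite (subset_trans sRUG) // gFnorm_trans.
    - exact: pnat_coprime (pgroupS (center_sub _) pF) p'R.
    - exact: (p'group_fixfree_center two_joined solG ncF pF).
    apply: (p'group_fixfree_center two_joined solG ncF pF);
      rewrite ?cycle_subG ?cycle_eq1 //.
    by rewrite /pgroup -orderE ou pnatE // inE.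
  case/trivgPn=> x /setIP[Rx cux] ntx.
  apply: (joined_centralizes two_joined (subsetP sRG x Rx) ntx Gu) => //.
  - apply: joined_coprime; first exact/cent1P.
    exact: coprime_dvdl (order_dvdG Rx) coRu.
  - by apply: subset_trans abR _; rewrite -cent_cycle centS ?cycle_subG.
  exact: abelian_sol.
apply: (joined_centralizes two_joined Gu ntu Gy) => //.
- by apply/joinedP; exists y; rewrite ?cycle_id.
- by rewrite -cent_cycle centsC cycle_subG.
exact: abelian_sol.
Qed.

(** For a prime [q <> p], a Sylow [q]-subgroup of [N] centralises [K], hence lies in [K]. *)
Lemma pgroup_norm_complement_quotient : p.-group (N / K).
Proof.
apply/pgroupP=> q pr_q; rewrite card_quotient // => qdv.
apply: contraLR qdv => neqqp; rewrite inE in neqqp.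
have [Q sylQ] := Sylow_exists q N; have [sQN qQ _] := and3P sylQ.
have sQK: Q \subset K.
  apply: subset_trans cent_complement_sub.
  by rewrite subsetI sQN (qgroup_cent_complement neqqp).
rewrite -p'natE //; apply: pnat_dvd (indexgS N sQK) _.
by case/and3P: sylQ.
Qed.

Lemma pgroup_Fitting2_quotient : p.-group (G / Fitting2 G).
Proof.
have nF2N : N \subset 'N(Fitting2 G) :=
  subset_trans sNG (normal_norm (Fitting2_normal G)).
have <-: ('F(G) * N) / Fitting2 G = G / Fitting2 G by rewrite mulFN.
rewrite quotientMl ?(subset_trans sFG) ?normal_norm ?Fitting2_normal //.
rewrite (quotientS1 (Fitting_sub_Fitting2 G)) mul1g.
have /homgP[f <-] := homg_quotientS nKN nF2N sKF2.
exact: morphim_pgroup pgroup_norm_complement_quotient.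
Qed.

(** An element of a complement [R] fixing some [x != 1] in [K] is joined to [x], so it centralises
    [K] and lies in [K :&: R = 1]. *)
Lemma Frobenius_norm_complement : G :!=: Fitting2 G -> [Frobenius N with kernel K].
Proof.
move=> neqGF2; have nsKN : K <| N by rewrite /normal sKN.
have hallK : Hall N K.
  rewrite /Hall sKN -card_quotient // coprime_sym.
  exact: pnat_coprime pgroup_norm_complement_quotient p'K.
have /splitsP[R /complP[tiKR defN]] := SchurZassenhaus_split hallK nsKN.
have sRN: R \subset N by rewrite -defN mulG_subr.
have sdN: K ><| R = N by rewrite sdprodE // (subset_trans sRN).
have pR: p.-group R.
  by rewrite /pgroup (card_isog (sdprod_isog sdN)); apply: pgroup_norm_complement_quotient.
apply/existsP; exists R; apply/Frobenius_semiregularP=> //.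
  by apply: contraNneq neqGF2 => R1; rewrite -mulFK -{1}mulFN -defN R1 mulg1.
move=> t /setD1P[ntt Rt]; apply/eqP; apply: contraR ntt => /trivgPn[x /setIP[Kx ctx] ntx].
have Nt := subsetP sRN t Rt; have Gt := subsetP sNG t Nt.
have coKt: coprime #|K| #[t].
  by rewrite coprime_sym; apply: pnat_coprime (mem_p_elt pR Rt) p'K.
have cKt: t \in 'C(K).
  apply: (joined_centralizes two_joined (subsetP sKG x Kx) ntx Gt) => //.
  - apply: joined_coprime; first exact/cent1P.
    exact: coprime_dvdl (order_dvdG Kx) coKt.
  - apply: subset_trans (cyclic_abelian cycK) _.
    by rewrite -cent_cycle centS ?cycle_subG.
  - exact: subsetP nKN t Nt.
  exact: solvableS sKG solG.
rewrite -in_set1 -[[set 1]]tiKR inE Rt andbT.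
by apply: (subsetP cent_complement_sub); rewrite inE Nt.
Qed.

Lemma two_Frobenius_noncyclic_Fitting : G :!=: Fitting2 G -> two_Frobenius G.
Proof.
move=> neqGF2; exists 'F(G)%G, (Fitting2 G)%G.
have ntF : 'F(G) != 1 by apply: contraNneq ncF => ->; apply: cyclic1.
have [_ _ _ prFF2 _] := Frobenius_context (set_Frobenius_compl defF2 Frobenius_Fitting2).
split=> //.
- by rewrite Fitting_normal Fitting2_normal.
- by split; rewrite // properEneq eq_sym neqGF2 Fitting2_sub.
- exact: Frobenius_Fitting2.
(* The Frobenius structure of [N] is carried to [G / 'F(G)], the image of [K] being
   [Fitting2 G / 'F(G)]. *)
have isoN := quotient_isom (subset_trans sNG nFG) tiFN.
have [injf imf] := isomP isoN.
have := injm_Frobenius_ker (subxx N) injf (Frobenius_norm_complement neqGF2).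
rewrite imf restrm_quotientE //=.
have ->: N / 'F(G) = G / 'F(G) by rewrite -quotientMidl mulFN.
have ->: K / 'F(G) = Fitting2 G / 'F(G) by rewrite -quotientMidl mulFK.
by [].
Qed.

End NoncyclicFitting.

Lemma noncyclic_Fitting_structure (gT : finGroupType) (G : {group gT}) :
    at_most_two_joined G -> solvable G -> ~~ cyclic 'F(G) ->
  exists p : nat,
    [/\ prime p, p.-group 'F(G),
        G :!=: 'F(G) ->
          [Frobenius Fitting2 G with kernel 'F(G)] /\ cyclic (Fitting2 G / 'F(G))
      & G :!=: Fitting2 G -> p.-group (G / Fitting2 G) /\ two_Frobenius G].
Proof.
move=> two_joined solG ncF; have [p pr_p pF] := Fitting_primary two_joined ncF.
have [K [defF2 p'K cycK]] := Fitting2_complement two_joined solG ncF pF.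
have ntK: G :!=: 'F(G) -> K :!=: 1.
  rewrite -(Fitting2_eq solG); apply: contraNneq => K1.
  by rewrite -(sdprodW defF2) K1 mulg1.
exists p; split=> // [neqGF | neqGF2].
  split; first exact: (Frobenius_Fitting2 two_joined solG ncF pF defF2 p'K (ntK neqGF)).
  by rewrite -(isog_cyclic (sdprod_isog defF2)).
have neqGF: G :!=: 'F(G).
  apply: contraNneq neqGF2 => eqGF; rewrite eqEsubset Fitting2_sub andbT.
  by rewrite {1}eqGF Fitting_sub_Fitting2.
have {}ntK := ntK neqGF; split.
  exact: (pgroup_Fitting2_quotient two_joined solG ncF pF defF2).
exact: (two_Frobenius_noncyclic_Fitting two_joined solG ncF pF defF2).
Qed.

(** * Reduction to a trivial cyclicizer *)

Section CentralQuotient.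

Variables (gT : finGroupType) (G Z : {group gT}).
Hypothesis sZ : Z \subset 'Z(G).

Let nsZG : Z <| G := sub_center_normal sZ.

Lemma central_sub_Fitting : Z \subset 'F(G).
Proof.
apply: Fitting_max nsZG (abelian_nil _).
exact: abelianS sZ (center_abelian G).
Qed.

(** The preimage of ['F(G / Z)] is a central extension of a nilpotent group, hence nilpotent. *)
Lemma quotient_central_Fitting : 'F(G / Z) = 'F(G) / Z.
Proof.
apply/eqP; rewrite eqEsubset andbC Fitting_max ?quotient_normal ?Fitting_normal //; last first.
  by rewrite quotient_nil ?Fitting_nil.
have [M defM sZM nsMG] := inv_quotientN nsZG (Fitting_normal (G / Z)).
rewrite defM quotientS // Fitting_max //; apply: nilpotent_central_quotient (_ : Z \subset _) _.
  rewrite subsetI sZM (subset_trans sZ) // subIset // orbC centS //.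
  exact: normal_sub.
by rewrite -defM Fitting_nil.
Qed.

Lemma quotient_central_Fitting2 : Fitting2 (G / Z) = Fitting2 G / Z.
Proof.
have sZF := central_sub_Fitting; have nsFG := Fitting_normal G.
have sFF2 := Fitting_sub_Fitting2 G; have sF2G := Fitting2_sub G.
have [f injf im_f] := third_isom sZF nsZG nsFG.
have eqF: Fitting2 G / Z / ('F(G) / Z) = 'F(G / Z / ('F(G) / Z)).
  apply: (injm_morphim_inj injf); rewrite ?quotientS ?Fitting_sub //.
  by rewrite injm_Fitting // !im_f // quotient_Fitting2.
rewrite /Fitting2 quotient_central_Fitting -eqF quotientGK //.
exact/quotient_normal/normalS/nsFG.
Qed.

End CentralQuotient.

Lemma joined_generator (gT : finGroupType) (G : {group gT}) (x y : gT) :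
    x \in G -> y \in G -> joined x y ->
  exists z, [/\ z \in G, x \in <[z]> & y \in <[z]>].
Proof.
move=> Gx Gy /cyclicP[z defz]; exists z.
rewrite -cycle_subG -defz gen_subG subUset !sub1set Gx Gy.
by rewrite !mem_gen // !inE eqxx ?orbT.
Qed.

(** * Joined elements and claws modulo the cyclicizer *)

Section Cyclicizer.

Variables (gT : finGroupType) (G : {group gT}).
Local Notation C := (cyclicizer G).

Lemma cyclicizerP x :
  reflect (x \in G /\ {in G, forall y, joined x y}) (x \in C).
Proof.
rewrite inE; apply: (iffP andP) => [[Gx /forall_inP Cx] | [Gx Cx]].
  by split=> // y Gy; apply: Cx.
by split=> //; apply/forall_inP=> y Gy; apply: Cx.
Qed.

Lemma cyclicizer_sub_center : C \subset 'Z(G).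
Proof.
apply/subsetP=> x /cyclicizerP[Gx Cx]; rewrite inE Gx; apply/centP=> y Gy.
exact/joined_commute/Cx.
Qed.

Let nsCG : C <| G := sub_center_normal cyclicizer_sub_center.
Let nCG : G \subset 'N(C) := normal_norm nsCG.

Lemma mem_cycle_coset x z : x \in G -> z \in G -> coset C x \in <[coset C z]> ->
  exists2 c, c \in C & x \in <[z]> :* c.
Proof.
move=> Gx Gz /cycleP[i]; have nCz := subsetP nCG z Gz.
rewrite -morphX // => /(rcoset_kercosetP (subsetP nCG x Gx) (groupX i nCz)).
case/rcosetP=> c Cc ->; exists c => //.
have /setIP[_ /centP/(_ _ Gz) czc] := subsetP cyclicizer_sub_center c Cc.
by rewrite (commuteX i czc) mem_rcoset mulgK mem_cycle.
Qed.

Lemma joined_coset : {in G &, forall x y, joined (coset C x) (coset C y) = joined x y}.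
Proof.
move=> x y Gx Gy; have [nCx nCy] := (subsetP nCG x Gx, subsetP nCG y Gy).
apply/idP/idP=> [jxy | /(joined_generator Gx Gy)[z [Gz /cycleP[i ->] /cycleP[j ->]]]]; last first.
  have nCz := subsetP nCG z Gz; apply/joinedP; exists (coset C z).
    by rewrite morphX ?mem_cycle.
  by rewrite morphX ?mem_cycle.
have [_ [/morphimP[z nCz Gz ->] zx zy]] :=
  joined_generator (mem_quotient C Gx) (mem_quotient C Gy) jxy.
have [c Cc xzc] := mem_cycle_coset Gx Gz zx.
have [d Cd yzd] := mem_cycle_coset Gy Gz zy.
have [[Gc Jc] [Gd Jd]] := (cyclicizerP _ Cc, cyclicizerP _ Cd).
(* The elements [c] and [d] of the cyclicizer are absorbed in turn: [<[v]>] contains [z] and [c],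
   and [<[w]>] contains [v] and [d]. *)
have [v [Gv cv zv]] := joined_generator Gc Gz (Jc z Gz).
have [w [Gw dw vw]] := joined_generator Gd Gv (Jd v Gv).
have zw: <[z]> \subset <[w]> by rewrite cycle_subG (subsetP _ _ zv) // cycle_subG.
have cw: c \in <[w]> by rewrite (subsetP _ _ cv) // cycle_subG.
apply/joinedP; exists w.
  by have /rcosetP[t zt ->] := xzc; rewrite groupM // (subsetP zw).
by have /rcosetP[t zt ->] := yzd; rewrite groupM // (subsetP zw).
Qed.

Lemma cyclic_quotient_cyclicizer (M : {group gT}) :
  M \subset G -> cyclic (M / C) -> cyclic M.
Proof.
move=> sMG cycMC; apply: contraT => /noncyclic_three_unjoined.
case=> a [b [_ [[Ma Mb _] [/negP[]]]]].
have [Ga Gb] := (subsetP sMG a Ma, subsetP sMG b Mb).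
rewrite -joined_coset //; apply: cyclicS cycMC.
by rewrite gen_subG subUset !sub1set !mem_quotient.
Qed.

(** A violation lifts to a claw with centre [x]: each leaf is unjoined to another leaf, and [x] lies
    outside the cyclicizer, so none of the four is dominating. *)
Lemma claw_free_at_most_two_joined :
  pepg_claw_free G -> at_most_two_joined (G / C).
Proof.
move=> clawG xC aC bC cC /morphimP[x nx Gx ->] ntx /morphimP[a na Ga ->].
case/morphimP=> [b nb Gb ->] /morphimP[c nc Gc ->].
rewrite !joined_coset // => jxa jxb jxc.
apply: contraT; rewrite !negb_or => /and3P[jab jac jbc]; case: clawG.
have C'x: x \notin C by apply: contra ntx => Cx; apply/eqP; apply: coset_id.
have vertex y z : y \in G -> z \in G -> ~~ joined y z -> y \in pepg_vertices G.
  move=> Gy Gz; rewrite inE Gy dominating_cyclicizer; apply: contra.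
  by case/cyclicizerP=> _; apply.
have jxx (y : gT) : joined y y by rewrite /joined setUid cycle_cyclic.
have neq (y z : gT) : ~~ joined y z -> y != z by apply: contraNneq => ->.
have neqx y z : joined x z -> ~~ joined y z -> x != y.
  by move=> jxz; apply: contraNneq => <-.
have jba: ~~ joined b a by rewrite joinedC.
have jca: ~~ joined c a by rewrite joinedC.
have jcb: ~~ joined c b by rewrite joinedC.
exists (fun i => nth x [:: x; a; b; c] i).
have nxa := neqx _ _ jxb jab; have nxb := neqx _ _ jxa jba; have nxc := neqx _ _ jxa jca.
have nab := neq _ _ jab; have nac := neq _ _ jac; have nbc := neq _ _ jbc.
have uniq_xabc: uniq [:: x; a; b; c].
  by rewrite /= !inE !negb_or nxa nxb nxc nab nac nbc.
have adj (i j : 'I_4) :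
  epg_adj (nth x [:: x; a; b; c] i) (nth x [:: x; a; b; c] j) = claw i j.
  rewrite /epg_adj /claw /= -/(joined _ _) -!(inj_eq val_inj).
  case: i j => [[|[|[|[|//]]]] ?] [[|[|[|[|//]]]] ?] /=;
    rewrite ?eqxx //= ?[joined _ x]joinedC ?jxa ?jxb ?jxc
      ?(negPf jab) ?(negPf jac) ?(negPf jbc) ?(negPf jba) ?(negPf jca) ?(negPf jcb)
      ?andbF ?andbT ?[_ == x]eq_sym ?nxa ?nxb ?nxc //.
split=> // [i j eqf | [[|[|[|[|//]]]] ?]].
- apply/val_inj/eqP; rewrite -(nth_uniq x _ _ uniq_xabc) ?ltn_ord //.
  exact/eqP.
- by rewrite inE Gx dominating_cyclicizer.
- exact: (vertex _ _ Ga Gb jab).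
- exact: (vertex _ _ Gb Ga jba).
exact: (vertex _ _ Gc Ga jca).
Qed.

End Cyclicizer.

Theorem theorem2p2 (gT : finGroupType) (G : {group gT})
    (solG : solvable G) (clawG : pepg_claw_free G) :
  (cyclic 'F(G) /\ cyclic (G / 'F(G)))
  \/
  (exists p : nat,
     [/\ prime p,
         p.-group ('F(G) / cyclicizer G) /\ ~~ cyclic ('F(G) / cyclicizer G),
         ~~ nilpotent G ->
           [Frobenius Fitting2 G / cyclicizer G with kernel 'F(G) / cyclicizer G]
           /\ cyclic (Fitting2 G / 'F(G))
       & G :!=: Fitting2 G ->
           p.-group (G / Fitting2 G) /\ two_Frobenius (G / cyclicizer G)%G]).
Proof.
have two_joined := claw_free_at_most_two_joined clawG.
have sCZ := cyclicizer_sub_center G.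
have sCF: cyclicizer G \subset 'F(G) := central_sub_Fitting sCZ.
have nsCG: cyclicizer G <| G := sub_center_normal sCZ.
have defF : 'F(G / cyclicizer G) = 'F(G) / cyclicizer G := quotient_central_Fitting sCZ.
have defF2 : Fitting2 (G / cyclicizer G) = Fitting2 G / cyclicizer G :=
  quotient_central_Fitting2 sCZ.
have solGC: solvable (G / cyclicizer G) := quotient_sol _ solG.
have sCF2 : cyclicizer G \subset Fitting2 G := subset_trans sCF (Fitting_sub_Fitting2 G).
have nsCF2 := normalS sCF2 (Fitting2_sub G) nsCG.
have isoGF := third_isog sCF nsCG (Fitting_normal G).
(* The case split is made in the quotient by the cyclicizer and carried back to [G] by the third
   isomorphism theorem. *)
have [cycF | ncF] := boolP (cyclic 'F(G / cyclicizer G)).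
  left; split.
    by apply: (cyclic_quotient_cyclicizer (Fitting_sub G)); rewrite -defF.
  have := cyclic_Fitting_quotient two_joined solGC cycF.
  by rewrite /= defF (isog_cyclic isoGF).
right; have [p [pr_p pF frobF2 frob2]] :=
  noncyclic_Fitting_structure two_joined solGC ncF.
rewrite /= defF defF2 in ncF pF frobF2 frob2.
exists p; split=> // [nilG' | neqGF2].
  (* Equality would make [G] a central extension of a nilpotent group. *)
  have neqGF : G / cyclicizer G != 'F(G) / cyclicizer G.
    apply: contra nilG' => /eqP eqGF; apply: (nilpotent_central_quotient sCZ).
    by rewrite /= eqGF quotient_nil ?Fitting_nil.
  have [frob cyc] := frobF2 neqGF; split=> //.
  have nsFF2 := normalS (Fitting_sub_Fitting2 G) (Fitting2_sub G) (Fitting_normal G).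
  by rewrite -(isog_cyclic (third_isog sCF nsCF2 nsFF2)).
have nsF2 := Fitting2_normal G.
have neqGF2C : G / cyclicizer G != Fitting2 G / cyclicizer G.
  apply: contra neqGF2 => /eqP/(congr1 (fun A => coset (cyclicizer G) @*^-1 A)).
  rewrite !quotientGK //. by move/eqP.
have [pG two_frob] := frob2 neqGF2C; split=> //.
rewrite /pgroup -(card_isog (third_isog sCF2 nsCG nsF2)); exact: pG.
Qed.
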